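(* For all $\mathfrak a,\mathfrak b\in\mathfrak D$ and $d\in\mathbb Z$, $S_{<d}(\mathfrak a\sqcup\!\sqcup\mathfrak b)=S_{<d}(\mathfrak a)S_{<d}(\mathfrak b)$ and $\zeta_A(\mathfrak a\sqcup\!\sqcup\mathfrak b)=\zeta_A(\mathfrak a)\zeta_A(\mathfrak b)$.
   Context: Let $q$ be a prime power, $A=\mathbb F_q[\theta]$, $A_+$ the set of monic polynomials in $A$, and $K_\infty=\mathbb F_q((1/\theta))$. Let $\Gamma=\{x_{n,\varepsilon}\}_{n\in\mathbb N,\varepsilon\in\mathbb F_q^*}$, $\langle\Gamma\rangle$ the set of words over $\Gamma$ (empty word $1$, juxtaposition = concatenation) and $\mathfrak D$ the $\mathbb F_q$-vector space with basis $\langle\Gamma\rangle$; write $x_n:=x_{n,1}$. For positive integers $r,s,j$ put $\Delta^j_{r,s}=(-1)^{r-1}\binom{j-1}{r-1}+(-1)^{s-1}\binom{j-1}{s-1}$ if $(q-1)\mid j$ and $0$ otherwise. The bilinear products $\diamond,\sqcup\!\sqcup$ on $\mathfrak D$ are defined recursively by $1\diamond\mathfrak a=\mathfrak a\diamond1=\mathfrak a$, $1\sqcup\!\sqcup\mathfrak a=\mathfrak a\sqcup\!\sqcup1=\mathfrak a$ and, for nonempty $\mathfrak a=x_{a,\alpha}\mathfrak a_-$, $\mathfrak b=x_{b,\beta}\mathfrak b_-$: $\mathfrak a\diamond\mathfrak b=x_{a+b,\alpha\beta}(\mathfrak a_-\sqcup\!\sqcup\mathfrak b_-)+\sum_{i+j=a+b}\Delta^j_{a,b}x_{i,\alpha\beta}(x_j\sqcup\!\sqcup(\mathfrak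 a_-\sqcup\!\sqcup\mathfrak b_-))$ and $\mathfrak a\sqcup\!\sqcup\mathfrak b=x_{a,\alpha}(\mathfrak a_-\sqcup\!\sqcup\mathfrak b)+x_{b,\beta}(\mathfrak a\sqcup\!\sqcup\mathfrak b_-)+\mathfrak a\diamond\mathfrak b$ ($i,j$ positive integers). For $d\in\mathbb Z$, $S_{<d},\zeta_A:\mathfrak D\to K_\infty$ are the $\mathbb F_q$-linear maps sending $1$ to $1$ and a word $x_{s_1,\varepsilon_1}\cdots x_{s_r,\varepsilon_r}$ to $S_{<d}=\sum \frac{\varepsilon_1^{\deg a_1}\cdots\varepsilon_r^{\deg a_r}}{a_1^{s_1}\cdots a_r^{s_r}}$ over $a_i\in A_+$ with $d>\deg a_1>\cdots>\deg a_r\ge0$, respectively $\zeta_A=$ the same sum over $a_i\in A_+$ with $\deg a_1>\cdots>\deg a_r\ge0$ (alternating multiple zeta values). *)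

(* Defs.v *)
From HB Require Import structures.
From mathcomp Require Import all_boot all_order all_algebra.
From Stdlib Require Import ClassicalEpsilon.
Set Implicit Arguments. Unset Strict Implicit. Unset Printing Implicit Defensive.
Import Order.TTheory GRing.Theory Num.Theory.
Local Open Scope ring_scope.

Section Defs.
Variable F : finFieldType.

(* K_infty = F((1/theta)) : formal Laurent series in 1/theta.          *)
(* x = \sum_{i >= 0} ser x i * theta^(lv x - i).                       *)
(* The representation is not canonical; equality in K_infty is        *)
(* equality of all coefficients (Keq).                                 *)
Record Kinf := MkK { lv : int; ser : nat -> F }.

Definition coef (x : Kinf) (k : int) : F :=
  if k <= lv x then ser x `|lv x - k|%N else 0.

Definition Keq (x y : Kinf) : Prop := forall k : int, coef x k = coef y k.

Definition zeroK : Kinf := MkK 0 (fun _ => 0).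
Definition constK (c : F) : Kinf := MkK 0 (fun i => if i == 0%N then c else 0).
Definition oneK : Kinf := constK 1.
Definition addK (x y : Kinf) : Kinf :=
  let m := Num.max (lv x) (lv y) in
  MkK m (fun i => coef x (m - i%:Z) + coef y (m - i%:Z)).
Definition mulK (x y : Kinf) : Kinf :=
  MkK (lv x + lv y) (fun n => \sum_(i < n.+1) ser x i * ser y (n - i)%N).
Definition scaleK (c : F) (x : Kinf) : Kinf := MkK (lv x) (fun i => c * ser x i).
Definition expK (x : Kinf) (s : nat) : Kinf := iter s (mulK x) oneK.

(* inverse of a power series u with u 0 <> 0: coefficients v_0..v_m *)
Fixpoint inv_list (u : nat -> F) (m : nat) : seq F :=
  match m with
  | 0 => [:: (u 0%N)^-1]
  | m'.+1 => let l := inv_list u m' in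
      rcons l (- (u 0%N)^-1 * \sum_(i < m'.+1) u i.+1 * nth 0 l (m' - i)%N)
  end.
Definition ser_inv (u : nat -> F) (n : nat) : F := nth 0 (inv_list u n) n.
(* multiplicative inverse (valid when ser x 0 <> 0, e.g. x a monic polynomial) *)
Definition invK (x : Kinf) : Kinf := MkK (- lv x) (ser_inv (ser x)).

Definition polyK (p : {poly F}) : Kinf :=
  let n := (size p).-1 in
  MkK n%:Z (fun i => if (i <= n)%N then p`_(n - i) else 0).

(* convergence in K_infty (for the 1/theta-adic topology) of a sequence
   indexed by d : int, d -> +oo *)
Definition Klim (u : int -> Kinf) (x : Kinf) : Prop :=
  forall k : int, exists D : int, forall d : int, D <= d ->
    forall j : int, k <= j -> coef (u d) j = coef x j.

Record Letter := Lt { lw : nat; le : F }.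
Definition word := seq Letter.
(* an element of frak D, as a formal F-linear combination of words *)
Definition Dsp := seq (F * word).

Definition validL (x : Letter) : bool := (0 < lw x)%N && (le x != 0).
Definition validD (a : Dsp) : bool := all (fun p => all validL p.2) a.

Definition cons_letter (x : Letter) (a : Dsp) : Dsp :=
  [seq (p.1, x :: p.2) | p <- a].
Definition scaleD (c : F) (a : Dsp) : Dsp := [seq (c * p.1, p.2) | p <- a].

Definition Delta (r s j : nat) : F :=
  if (#|F|.-1 %| j)%N then
    (-1) ^+ r.-1 *+ 'C(j.-1, r.-1) + (-1) ^+ s.-1 *+ 'C(j.-1, s.-1)
  else 0.

(* shuffle of two words, with fuel (size u + size v suffices);
   the last two summands of the nonempty case are  x_{a,alpha}a_- <> x_{b,beta}b_- *)
Fixpoint sh (fuel : nat) (u v : word) {struct fuel} : Dsp :=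
  match fuel with
  | 0 => if u is [::] then [:: (1, v)] else if v is [::] then [:: (1, u)] else [::]
  | f.+1 =>
    match u, v with
    | [::], _ => [:: (1, v)]
    | _, [::] => [:: (1, u)]
    | x :: u', y :: v' =>
      let w := sh f u' v' in
      let ab := (lw x + lw y)%N in
      let e := le x * le y in
      cons_letter x (sh f u' v) ++ cons_letter y (sh f u v') ++
      cons_letter (Lt ab e) w ++
      flatten [seq scaleD (Delta (lw x) (lw y) j)
                 (cons_letter (Lt (ab - j) e)
                    (flatten [seq scaleD p.1 (sh f [:: Lt j 1] p.2) | p <- w]))
              | j <- iota 1 ab.-1]
    end
  end.

Definition shuffle (u v : word) : Dsp := sh (size u + size v) u v.

Definition shD (a b : Dsp) : Dsp :=
  flatten [seq scaleD (p.1 * p'.1) (shuffle p.2 p'.2) | p <- a, p' <- b].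

Definition monic_of (n : nat) (f : {ffun 'I_n -> F}) : {poly F} :=
  'X^n + \sum_(i < n) f i *: 'X^i.

(* S_{<d} on words: sum over d > deg a_1 > ... > deg a_r >= 0, a_i monic *)
Fixpoint Sw (w : word) (d : int) : Kinf :=
  match w with
  | [::] => oneK
  | x :: w' =>
    \big[addK/zeroK]_(n < `|d|%N | n%:Z < d)
      \big[addK/zeroK]_(f : {ffun 'I_n -> F})
        mulK (constK (le x ^+ n))
             (mulK (expK (invK (polyK (monic_of f))) (lw x)) (Sw w' n%:Z))
  end.

Definition SD (a : Dsp) (d : int) : Kinf :=
  \big[addK/zeroK]_(p <- a) scaleK p.1 (Sw p.2 d).

Definition zetaW (w : word) : Kinf :=
  epsilon (inhabits zeroK) (fun x => Klim (fun d => Sw w d) x).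

Definition zetaD (a : Dsp) : Kinf :=
  \big[addK/zeroK]_(p <- a) scaleK p.1 (zetaW p.2).

End Defs.

(* Main.v *)
(** Write S_n(s) for the sum of 1/a^s over monic a of degree n. Expanding
    1/(f^a g^b) for distinct monic f, g of degree n by partial fractions in
    f - g, and using that f - g runs over all nonzero polynomials of degree < n,
    gives Chen's formula
      S_n(a) S_n(b) = S_n(a+b) + sum_{i+j=a+b} Delta^j_{a,b} S_n(i) S_{<n}(j),
    where the sum of c^(-j) over the nonzero constants c is -1 or 0 according to
    whether q-1 divides j. The product formula for S_{<d} follows by induction
    on the total length of the two words, splitting a double sum over pairs of
    leading degrees into n > m, n < m and n = m. All the values S_{<d} are power
    series in 1/theta, so the identities are proved in that ring, and the
    coefficient of theta^(-i) in S_{<d} does not depend on d > i, which yields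
    the statement for the limit zeta_A. *)
From HB Require Import structures.
Require Import Defs.
From mathcomp Require Import all_boot all_order all_algebra.
From mathcomp Require Import finfield ring zify boolp.
From Stdlib Require Import ClassicalEpsilon.
Set Implicit Arguments. Unset Strict Implicit. Unset Printing Implicit Defensive.
Import Order.TTheory GRing.Theory Num.Theory.
Local Open Scope ring_scope.

(** * Partial fractions and Chen's formula *)

(* The binomial coefficient C(j-1, s-1), extended to j = 0 and s = 0 so that
   Pascal's rule bin_predS holds without side conditions. *)
Definition bin_pred (j s : nat) : nat :=
  match j, s with
  | 0, 0 => 1
  | j'.+1, s'.+1 => 'C(j', s')
  | _, _ => 0
  end.

Lemma bin_predS j s : bin_pred j.+1 s.+1 = (bin_pred j s.+1 + bin_pred j s)%N.
Proof. by case: j s => [|j] [|s] //=; rewrite ?bin0 // binS. Qed.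

(* The hypothesis is 1/(ab) = 1/(a-b) (1/b - 1/a) with A, B, C = 1/a, 1/b, 1/(a-b). *)
Lemma partial_fractions (R : comNzRingType) (A B C : R) n r s :
  A * B = C * (B - A) -> (r + s = n.+1)%N ->
  A ^+ r * B ^+ s = \sum_(j < n.+1)
    ((-1) ^+ s *+ bin_pred j s * C ^+ j * A ^+ (n.+1 - j) +
     (-1) ^+ r *+ bin_pred j r * (- C) ^+ j * B ^+ (n.+1 - j)).
Proof.
move=> AB; elim: n r s => [|n IHn] [|r] [|s] // rs.
- by case: s rs => // _; rewrite big_ord1 /= mulr0n mulr1n; ring.
- by case: r rs => // _; rewrite big_ord1 /= mulr0n mulr1n; ring.
- lia.
(* For [r = 0] only [j = 0] survives, through [bin_pred 0 0 = 1]: the binomials with [j] at most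
   [n.+1] vanish. *)
- rewrite -rs big_ord_recl [X in _ = _ + X]big1 => [|i _] /=.
    by rewrite mulr0n mulr1n; ring.
  have -> : 'C(i, s) = 0%N by rewrite bin_small //; have := ltn_ord i; lia.
  by rewrite !mulr0n; ring.
- rewrite -rs addn0 big_ord_recl [X in _ = _ + X]big1 => [|i _] /=.
    by rewrite mulr0n mulr1n; ring.
  have -> : 'C(i, r) = 0%N by rewrite bin_small //; have := ltn_ord i; lia.
  by rewrite !mulr0n; ring.
(* One application of the hypothesis lowers either exponent. The factor [C] shifts the index [j] by
   one, and Pascal's rule merges the two sums. *)
have -> : A ^+ r.+1 * B ^+ s.+1 = C * (A ^+ r * B ^+ s.+1 - A ^+ r.+1 * B ^+ s).
  transitivity (A ^+ r * B ^+ s * (A * B)); first by rewrite !exprS; ring.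
  by rewrite AB !exprS; ring.
rewrite !IHn; try lia.
rewrite -sumrB mulr_sumr [RHS]big_ord_recl /= !mulr0n !mul0r !add0r.
apply: eq_bigr => i _; rewrite subSS /bump add1n.
rewrite -/(bin_pred i.+1 s.+1) -/(bin_pred i.+1 r.+1) !bin_predS.
rewrite !mulrnDr !exprS !mulN1r !mulNrn.
move: (_ *+ bin_pred i s.+1) (_ *+ bin_pred i s) (_ *+ bin_pred i r.+1).
move: (_ *+ bin_pred i r) (A ^+ _) (B ^+ _) (C ^+ i) ((- C) ^+ i) => *.
by ring.
Qed.

(** * Sums over the finite field and over polynomials of bounded degree *)

Section PowerSums.
Variable F : finFieldType.

(** Translation by 1 permutes [F], so the sum of all elements equals itself plus [#|F|%:R]. *)
Lemma finField_card_natr : #|F|%:R = 0 :> F.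
Proof.
have e (x : F) : x ^+ #|F| = x by exact: expf_card.
pose S : F := \sum_(x : F) x.
have : S = \sum_(x : F) (x + 1).
  by rewrite {1}/S (reindex_inj (addIr 1)).
rewrite big_split /= sumr_const -/S => /eqP.
by rewrite -{1}[S]addr0 (inj_eq (addrI _)) => /eqP <-.
Qed.

Lemma expf_card_pred (c : F) : c != 0 -> c ^+ #|F|.-1 = 1.
Proof.
move=> c0; apply: (mulfI c0); rewrite -exprS prednK ?expf_card ?mulr1 //.
by apply/card_gt0P; exists 0.
Qed.

(** Otherwise all $q-1$ nonzero elements would be roots of unity of order dividing [j %% #|F|.-1], a
    positive exponent smaller than $q-1$. *)
Lemma exp_nontrivial j : ~~ (#|F|.-1 %| j)%N -> exists2 g : F, g != 0 & g ^+ j != 1.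
Proof.
move=> ndv; case/boolP: [exists g : F, (g != 0) && (g ^+ j != 1)].
  by case/existsP=> g /andP[]; exists g.
rewrite negb_exists => /forallP all1; case/negP: ndv.
have q1 : (1 < #|F|)%N := finNzRing_gt1 F.
rewrite /dvdn; apply: contraT => m0.
have : (#|F|.-1 <= j %% #|F|.-1)%N.
  rewrite -{1}(cardC1 (0 : F)) cardE; apply: max_unity_roots; rewrite ?enum_uniq ?lt0n //.
  apply/allP => x; rewrite mem_enum inE /= => x0; have := all1 x.
  rewrite x0 /= negbK {1}(divn_eq j #|F|.-1) exprD mulnC exprM.
  by rewrite expf_card_pred // expr1n mul1r => ?; rewrite unity_rootE.
have : (j %% #|F|.-1 < #|F|.-1)%N by rewrite ltn_mod; lia.
by rewrite ltnNge => /negP.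
Qed.

(** If $q-1$ divides $j$, this adds $q-1$ ones. Otherwise substituting $gc$ for $c$ multiplies the
    sum by $g^{-j} \ne 1$, so it vanishes. *)
Lemma sum_inv_powers j :
  \sum_(c : F | c != 0) c^-1 ^+ j = if (#|F|.-1 %| j)%N then -1 else 0.
Proof.
case: ifPn => [/dvdnP[k ->]|ndv].
  rewrite (eq_bigr (fun=> 1)) => [|c c0].
    have := finField_card_natr; rewrite -sum1_card natr_sum (bigD1 0) //=.
    by move/eqP; rewrite addrC addr_eq0 => /eqP.
  by rewrite mulnC exprM expf_card_pred ?invr_eq0 // expr1n.
have [g g0 gj] := exp_nontrivial ndv.
set S := \sum_(_ | _) _.
have e : S = g^-1 ^+ j * S.
  rewrite mulr_sumr {1}/S (reindex_inj (mulfI g0)) /=.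
  apply: eq_big => [c|c _]; first by rewrite mulf_eq0 (negPf g0).
  by rewrite invfM exprMn.
have : (1 - g^-1 ^+ j) * S = 0 by rewrite mulrBl mul1r -e subrr.
move/eqP; rewrite mulf_eq0 subr_eq0 => /orP[|/eqP //].
by rewrite exprVn eq_sym invr_eq1 (negPf gj).
Qed.

Definition poly_of n (h : {ffun 'I_n -> F}) : {poly F} := \sum_(i < n) h i *: 'X^i.

(** [inv] models $p \mapsto 1/p$ with $1/0 = 0$. The hypotheses never mention $p$ as an element of
    [R]: in power series in $1/\theta$ the inverse of $p$ exists, but a nonconstant $p$ does not. *)
Variables (R : comAlgType F) (inv : {poly F} -> R).
Hypothesis inv0 : inv 0 = 0.
Hypothesis invZ : forall c p, c != 0 -> inv (c *: p) = c^-1 *: inv p.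
Hypothesis inv_mul : forall p p', p != 0 -> p' != 0 -> p != p' ->
  inv p * inv p' = inv (p - p') * (inv p' - inv p).

Definition power_sum n s : R := \sum_(f : {ffun 'I_n -> F}) inv (monic_of f) ^+ s.

Lemma poly_ofZ n c (h : {ffun 'I_n -> F}) : poly_of [ffun i => c * h i] = c *: poly_of h.
Proof.
by rewrite /poly_of scaler_sumr; apply: eq_bigr => i _; rewrite ffunE scalerA.
Qed.

Lemma poly_ofB n (f g : {ffun 'I_n -> F}) : poly_of (f - g) = monic_of f - monic_of g.
Proof.
rewrite /monic_of opprD addrACA subrr add0r -sumrB.
by apply: eq_bigr => i _; rewrite !ffunE scalerBl.
Qed.

Lemma coef_poly_of n (h : {ffun 'I_n -> F}) (i : 'I_n) : (poly_of h)`_i = h i.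
Proof.
rewrite /poly_of coef_sum (bigD1 i) //= coefZ coefXn eqxx mulr1 big1 ?addr0 // => k ki.
by rewrite coefZ coefXn eq_sym (_ : (_ == _)%N = false) ?mulr0 //; apply: negPf.
Qed.

Lemma poly_of_eq0 n (h : {ffun 'I_n -> F}) : poly_of h = 0 -> h = 0.
Proof. by move=> h0; apply/ffunP => i; rewrite -coef_poly_of h0 coef0 ffunE. Qed.

Lemma size_poly_of n (h : {ffun 'I_n -> F}) : (size (poly_of h) <= n)%N.
Proof.
apply: (leq_trans (size_sum _ _ _)); apply/bigmax_leqP => i _.
by apply: (leq_trans (size_scale_leq _ _)); rewrite size_polyXn.
Qed.

Lemma size_monic_of n (f : {ffun 'I_n -> F}) : size (monic_of f) = n.+1.
Proof. by rewrite size_polyDl size_polyXn // ltnS size_poly_of. Qed.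

Lemma monic_of_neq0 n (f : {ffun 'I_n -> F}) : monic_of f != 0.
Proof. by rewrite -size_poly_eq0 size_monic_of. Qed.

Definition ffun_rcons n (ch : F * {ffun 'I_n -> F}) : {ffun 'I_n.+1 -> F} :=
  [ffun i => if unlift ord_max i is Some k then ch.2 k else ch.1].

Lemma ffun_rcons_bij n : bijective (@ffun_rcons n).
Proof.
exists (fun h : {ffun 'I_n.+1 -> F} => (h ord_max, [ffun k => h (lift ord_max k)])).
  case=> c g /=; congr (_, _); first by rewrite ffunE unlift_none.
  by apply/ffunP => k; rewrite !ffunE liftK.
move=> h; apply/ffunP => i; rewrite !ffunE.
by case: unliftP => [k ->|->]; rewrite ?ffunE.
Qed.

Lemma poly_of_rcons n c (h : {ffun 'I_n -> F}) :
  poly_of (ffun_rcons (c, h)) = c *: 'X^n + poly_of h.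
Proof.
rewrite /poly_of big_ord_recr /= addrC ffunE unlift_none; congr (_ + _).
apply: eq_bigr => i _; rewrite ffunE.
have -> : widen_ord (leqnSn n) i = lift ord_max i.
  by apply: val_inj; rewrite /= /bump leqNgt ltn_ord.
by rewrite liftK.
Qed.

(** A nonzero polynomial of degree below $n$ is uniquely a constant times a monic one, so the sum
    factors through [sum_inv_powers]. The zero polynomial contributes 0 since [j] is positive. *)
Lemma sum_inv_poly n j : (0 < j)%N ->
  \sum_(h : {ffun 'I_n -> F}) inv (poly_of h) ^+ j =
  if (#|F|.-1 %| j)%N then - \sum_(m < n) power_sum m j else 0.
Proof.
move=> j0; elim: n => [|n IHn].
  rewrite big1 => [|h _]; last by rewrite /poly_of big_ord0 inv0 expr0n eqn0Ngt j0.
  by rewrite big_ord0 oppr0 if_same.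
rewrite (reindex (@ffun_rcons n)); last exact: onW_bij (ffun_rcons_bij n).
rewrite -(pair_bigA _ (fun c h => inv (poly_of (ffun_rcons (c, h))) ^+ j)) /=.
under eq_bigr do under eq_bigr do rewrite poly_of_rcons.
(* Top coefficient 0 leaves the induction hypothesis. For [c] nonzero, replacing [h] by [c * h]
   makes the polynomial [c] times a monic one of degree [n]. *)
rewrite (bigD1 0) //=.
under eq_bigr do rewrite scale0r add0r.
rewrite IHn; under eq_bigr => c c0.
  have mulc_inj : injective (fun h : {ffun 'I_n -> F} => [ffun i => c * h i]).
    by move=> f g /ffunP fg; apply/ffunP => i; have := fg i; rewrite !ffunE => /mulfI->.
  rewrite (reindex_inj mulc_inj) /=.
  under eq_bigr do rewrite poly_ofZ -scalerDr invZ // exprZn.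
  rewrite -scaler_sumr -/(power_sum n j); over.
rewrite -scaler_suml sum_inv_powers; case: ifP => _; last by rewrite scale0r add0r.
by rewrite scaleN1r big_ord_recr /= opprD.
Qed.

Lemma power_sum_mul n a b : (0 < a)%N -> (0 < b)%N ->
  power_sum n a * power_sum n b = power_sum n (a + b) +
  \sum_(j <- iota 1 (a + b).-1)
     Delta F a b j *: (power_sum n (a + b - j) * \sum_(m < n) power_sum m j).
Proof.
move=> a0 b0; rewrite {1 2}/power_sum big_distrl /=.
under eq_bigr do rewrite big_distrr /=.
pose N := (a + b).-1; have abE : (a + b = N.+1)%N by rewrite /N; lia.
pose T (f g : {ffun 'I_n -> F}) (j : nat) :=
  (-1) ^+ b *+ bin_pred j b * inv (poly_of (f - g)) ^+ j * inv (monic_of f) ^+ (a + b - j) +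
  (-1) ^+ a *+ bin_pred j a * inv (poly_of (g - f)) ^+ j * inv (monic_of g) ^+ (a + b - j).
(* On the diagonal every [T f f j] vanishes, by [inv 0 = 0] for positive [j] and by [bin_pred] for
   [j = 0]; hence the [T] sum may run over all pairs. *)
have step (f g : {ffun 'I_n -> F}) :
  inv (monic_of f) ^+ a * inv (monic_of g) ^+ b =
  (if g == f then inv (monic_of f) ^+ (a + b) else 0) + \sum_(j < N.+1) T f g j.
  case: eqP => [->|/eqP gf].
    rewrite big1 ?addr0 -?exprD // => j _; rewrite /T subrr.
    have -> : poly_of 0 = 0 :> {poly F}.
      by move=> m; rewrite /poly_of big1 // => i _; rewrite ffunE scale0r.
    rewrite inv0; case: (posnP j) => [->|jp].
      by case: (a) a0 => // ? _; case: (b) b0 => // ? _; rewrite /= !mulr0n !mul0r addr0.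
    by rewrite expr0n eqn0Ngt jp /= !mulr0 !mul0r addr0.
  have neq : monic_of f != monic_of g.
    rewrite -subr_eq0 -poly_ofB; apply: contra gf => /eqP/poly_of_eq0/eqP.
    by rewrite subr_eq0 eq_sym.
  have := inv_mul (monic_of_neq0 f) (monic_of_neq0 g) neq.
  move/partial_fractions => /(_ _ a b abE) ->; rewrite add0r -abE.
  apply: eq_bigr => j _; rewrite /T !poly_ofB.
  rewrite -[monic_of g - _]opprB -[- (monic_of f - _)]scaleN1r invZ ?oppr_eq0 ?oner_eq0 //.
  by rewrite invrN1 scaleN1r.
under eq_bigr do under eq_bigr do rewrite step.
under eq_bigr do rewrite big_split /= -big_mkcond big_pred1_eq.
rewrite big_split /= -/(power_sum n (a + b)); congr (_ + _).
under eq_bigr do rewrite exchange_big /=.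
rewrite exchange_big /= big_ord_recl [X in X + _]big1 ?add0r => [|f _]; last first.
  rewrite big1 // => g _; rewrite /T.
  by case: (a) a0 => // ? _; case: (b) b0 => // ? _; rewrite /= !mulr0n !mul0r addr0.
have -> : iota 1 (a + b).-1 = index_iota 1 N.+1 by rewrite /index_iota subn1.
rewrite big_add1 /= big_mkord.
apply: eq_bigr => -[j /= jN] _; rewrite /bump /= add1n.
rewrite /T; under eq_bigr do rewrite big_split /=.
rewrite big_split /=.
(* For fixed [f], the difference [f - g] runs over all coefficient vectors, so the double sum
   factors. *)
have shiftl (i k : nat) : \sum_(f : {ffun 'I_n -> F}) \sum_(g : {ffun 'I_n -> F})
    inv (poly_of (f - g)) ^+ i * inv (monic_of f) ^+ k =
    (\sum_(h : {ffun 'I_n -> F}) inv (poly_of h) ^+ i) * power_sum n k.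
  rewrite mulrC big_distrl /=; apply: eq_bigr => f _; rewrite big_distrr /=.
  rewrite (reindex_inj (can_inj (subKr f))) /=; apply: eq_bigr => g _.
  by rewrite subKr mulrC.
have e1 c : \sum_(f : {ffun 'I_n -> F}) \sum_(g : {ffun 'I_n -> F})
    c * inv (poly_of (f - g)) ^+ j.+1 * inv (monic_of f) ^+ (a + b - j.+1) =
    c * ((\sum_(h : {ffun 'I_n -> F}) inv (poly_of h) ^+ j.+1) * power_sum n (a + b - j.+1)).
  rewrite -shiftl mulr_sumr; apply: eq_bigr => f _; rewrite mulr_sumr.
  by apply: eq_bigr => g _; rewrite mulrA.
rewrite e1 exchange_big /= e1 -mulrDl sum_inv_poly // /Delta /=.
case: ifP => _; last by rewrite mul0r mulr0 scale0r.
(* The sign gained in passing from $(-1)^s$ to $(-1)^{s-1}$ cancels the minus sign of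
   [sum_inv_poly]. *)
have coefE s : (0 < s)%N ->
    (-1) ^+ s *+ bin_pred j.+1 s = - ((-1) ^+ s.-1 *+ 'C(j, s.-1))%:A :> R.
  case: s => // s _; rewrite exprS mulN1r mulNrn /= -/(in_alg R _).
  by rewrite rmorphMn rmorphXn rmorphN1.
rewrite !coefE // -opprD -scalerDl [X in _ * X]mulNr mulrNN mulr_algl.
by rewrite [X in _ *: X = _]mulrC [X in X *: _ = _]addrC.
Qed.
End PowerSums.

(** * The shuffle product of nested sums *)

(** Words carry no declared equality test, so a predicate on the entries replaces list
    membership. *)
Lemma eq_bigr_all (V : nmodType) (T : Type) (Q : pred T) (s : seq T) (f g : T -> V) :
  all Q s -> (forall x, Q x -> f x = g x) -> \sum_(x <- s) f x = \sum_(x <- s) g x.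
Proof.
move=> + fg; elim: s => [|x s IHs] /=; first by rewrite !big_nil.
by case/andP=> Qx Qs; rewrite !big_cons fg // IHs.
Qed.

Section Shuffle.
Variable F : finFieldType.

Definition valid_le (n : nat) (p : F * word F) := (size p.2 <= n)%N && all (@validL F) p.2.

Lemma all_scaleD n c (a : Dsp F) : all (valid_le n) (scaleD c a) = all (valid_le n) a.
Proof. by rewrite /scaleD all_map. Qed.

Lemma all_cons_letter n x (a : Dsp F) :
  validL x -> all (valid_le n) a -> all (valid_le n.+1) (cons_letter x a).
Proof.
by move=> vx; rewrite /cons_letter all_map; apply: sub_all => p; rewrite /valid_le /= vx.
Qed.

Lemma all_valid_le_trans m n (a : Dsp F) :
  (m <= n)%N -> all (valid_le m) a -> all (valid_le n) a.
Proof. by move=> mn; apply: sub_all => p /andP[pm v]; rewrite /valid_le v (leq_trans pm). Qed.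

Lemma all_flatten_map (T : Type) (Q : pred T) (P : pred (F * word F)) (s : seq T) f :
  all Q s -> (forall x, Q x -> all P (f x)) -> all P (flatten (map f s)).
Proof.
move=> + QP; elim: s => //= x s IHs /andP[Qx Qs].
by rewrite all_cat QP ?IHs.
Qed.

(** The length bound guarantees enough fuel for the inner product of $x_j$ with each word of the
    shuffle of the tails. *)
Lemma sh_valid f (u v : word F) : all (@validL F) u -> all (@validL F) v ->
  all (valid_le (size u + size v)) (sh f u v).
Proof.
elim: f u v => [|f IHf] [|x u] [|y v] //= vu vv;
  rewrite /valid_le /= ?vu ?vv ?addn0 ?leqnn //.
case/andP: (vu) => vx vu'; case/andP: (vv) => vy vv'.
case/andP: (vx) => x0 ex; case/andP: (vy) => y0 ey.
have vxy i : (0 < i)%N -> validL (Lt i (le x * le y)).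
  by move=> i0; rewrite /validL /= i0 mulf_neq0.
rewrite !all_cat; apply/and4P; split.
- by apply: all_cons_letter => //; apply: (IHf u (y :: v)).
- by rewrite addnS; apply: all_cons_letter => //; apply: (IHf (x :: u) v).
- apply: (@all_valid_le_trans (size u + size v).+1); first by lia.
  by apply: all_cons_letter; [apply: vxy; lia | apply: IHf].
apply: (@all_flatten_map _ (mem (iota 1 (lw x + lw y).-1))) => [|j].
  exact/allP.
rewrite inE mem_iota => jab; rewrite all_scaleD addnS.
apply: all_cons_letter; first by apply: vxy; lia.
apply: (@all_flatten_map _ _ _ _ _ (IHf u v vu' vv')) => p /andP[sp vp].
rewrite all_scaleD; apply: (@all_valid_le_trans (1 + size p.2)); first by rewrite add1n ltnS.
by apply: IHf; rewrite //= /validL /= oner_eq0; lia.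
Qed.

(** [P n s] stands for the power sum over monic polynomials of degree $n$; the shuffle formula is
    derived from [P_mul] alone. *)
Variables (R : comAlgType F) (P : nat -> nat -> R).
Hypothesis P_mul : forall n a b, (0 < a)%N -> (0 < b)%N ->
  P n a * P n b = P n (a + b)%N + \sum_(j <- iota 1 (a + b).-1)
    Delta F a b j *: (P n (a + b - j)%N * \sum_(m < n) P m j).

Fixpoint psum (w : word F) (d : nat) : R :=
  if w is x :: w' then \sum_(n < d) le x ^+ n *: (P n (lw x) * psum w' n) else 1.

Definition psumD (a : Dsp F) (d : nat) : R := \sum_(p <- a) p.1 *: psum p.2 d.

Lemma psumD_scale c a d : psumD (scaleD c a) d = c *: psumD a d.
Proof.
by rewrite /psumD /scaleD big_map scaler_sumr; apply: eq_bigr => p _; rewrite scalerA.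
Qed.

Lemma psumD_cat a b d : psumD (a ++ b) d = psumD a d + psumD b d.
Proof. exact: big_cat. Qed.

Lemma psumD_flatten (T : Type) (s : seq T) (f : T -> Dsp F) d :
  psumD (flatten [seq f x | x <- s]) d = \sum_(x <- s) psumD (f x) d.
Proof. by rewrite /psumD big_flatten big_map. Qed.

Lemma psumD_cons x a d :
  psumD (cons_letter x a) d = \sum_(n < d) le x ^+ n *: (P n (lw x) * psumD a n).
Proof.
rewrite /psumD /cons_letter big_map /=.
under eq_bigr do rewrite scaler_sumr.
rewrite exchange_big /=; apply: eq_bigr => n _.
rewrite mulr_sumr scaler_sumr; apply: eq_bigr => p _.
by rewrite -scalerAr !scalerA mulrC.
Qed.

Lemma psumD1 w d : psumD [:: (1, w)] d = psum w d.
Proof. by rewrite /psumD big_seq1 scale1r. Qed.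

Lemma mul_sums_ord (f g : nat -> R) d :
  (\sum_(n < d) f n) * (\sum_(n < d) g n) =
  \sum_(n < d) f n * (\sum_(m < n) g m) + \sum_(n < d) g n * (\sum_(m < n) f m) +
  \sum_(n < d) f n * g n.
Proof.
elim: d => [|d IHd]; first by rewrite !big_ord0; ring.
by rewrite !big_ord_recr /= mulrDl !mulrDr IHd; ring.
Qed.

(** The induction is on the fuel: the words multiplied by $x_j$ come out of a shuffle and need not
    be subwords of [u] or [v]. *)
Lemma psum_sh f u v d : all (@validL F) u -> all (@validL F) v ->
  (size u + size v <= f)%N -> psumD (sh f u v) d = psum u d * psum v d.
Proof.
elim: f u v d => [|f IHf] [|x u] [|y v] d //= vu vv suv;
  rewrite ?psumD1 ?mul1r ?mulr1 //.
case/andP: (vu) => /andP[x0 ex] vu'; case/andP: (vv) => /andP[y0 ey] vv'.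
have suv1 : ((size u).+1 + size v <= f)%N by lia.
have suv2 : (size u + size v <= f)%N by lia.
rewrite !psumD_cat !psumD_cons psumD_flatten.
under [X in _ + (_ + (_ + X))]eq_bigr do rewrite psumD_scale psumD_cons /=.
under [X in X + (_ + _)]eq_bigr do rewrite IHf //=.
under [X in _ + (X + _)]eq_bigr do rewrite IHf //=.
under [X in _ + (_ + (X + _))]eq_bigr do rewrite IHf //=.
have fl j n : (0 < j)%N ->
  psumD (flatten [seq scaleD p.1 (sh f [:: Lt j 1] p.2) | p <- sh f u v]) n =
  (\sum_(m < n) P m j) * (psum u n * psum v n).
  move=> j0; rewrite psumD_flatten -IHf //.
  rewrite {2}/psumD mulr_sumr; apply: eq_bigr_all (sh_valid f vu' vv') _ => p /andP[sp vp].
  rewrite psumD_scale IHf //=; last first.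
  - by rewrite add1n; lia.
  - by rewrite /validL /= j0 oner_eq0.
  rewrite -scalerAr; congr (_ *: (_ * _)).
  by apply: eq_bigr => m _; rewrite expr1n scale1r mulr1.
rewrite (mul_sums_ord (fun n => le x ^+ n *: (P n (lw x) * psum u n))
  (fun n => le y ^+ n *: (P n (lw y) * psum v n))) addrA; congr (_ + _ + _).
- by apply: eq_bigr => n _; rewrite -scalerAl mulrA.
- by apply: eq_bigr => n _; rewrite -scalerAl -mulrA [psum v n * _]mulrC.
rewrite (@eq_big_seq _ _ _ _ _ _ (fun j => \sum_(n < d) (le x * le y) ^+ n *:
  (Delta F (lw x) (lw y) j *: (P n (lw x + lw y - j)%N * \sum_(m < n) P m j) *
   (psum u n * psum v n)))); last first.
  move=> j; rewrite mem_iota => /andP[j0 _]; rewrite scaler_sumr.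
  apply: eq_bigr => n _; rewrite fl // scalerA mulrC -scalerA; congr (_ *: _).
  by rewrite -scalerAl mulrA.
(* After the common factors at degree [n] are taken out, the diagonal terms are the right-hand side
   of [P_mul]. *)
rewrite exchange_big /= -big_split; apply: eq_bigr => n _ /=.
rewrite -scaler_sumr -scalerDr -mulr_suml -mulrDl -P_mul //.
by rewrite exprMn -scalerA -!scalerAl -!scalerAr mulrACA.
Qed.

Lemma psumD_shD a b d : validD a -> validD b ->
  psumD (shD a b) d = psumD a d * psumD b d.
Proof.
rewrite /validD => + vb; elim: a => [|p a IHa] /=; first by rewrite /psumD !big_nil mul0r.
case/andP=> vp va; rewrite /shD /= flatten_cat psumD_cat IHa // psumD_flatten.
have -> : psumD (p :: a) d = p.1 *: psum p.2 d + psumD a d by rewrite /psumD big_cons.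
rewrite mulrDl; congr (_ + _); rewrite [psumD b d]/psumD mulr_sumr.
apply: eq_bigr_all vb _ => p' vp'.
by rewrite psumD_scale psum_sh // -scalerAl -scalerAr scalerA.
Qed.
End Shuffle.

(** * Power series and inverses of polynomials *)

(** A named type, to which the Cauchy product is attached as ring multiplication. *)
Definition pser (F : Type) : Type := nat -> F.

HB.instance Definition _ (F : Type) := gen_eqMixin (pser F).
HB.instance Definition _ (F : Type) := gen_choiceMixin (pser F).

Section PowerSeries.
Variable F : comNzRingType.
Implicit Types f g h : pser F.

Definition pser_zero : pser F := fun _ => 0.
Definition pser_opp f : pser F := fun i => - f i.
Definition pser_add f g : pser F := fun i => f i + g i.
Definition pser_scale (c : F) f : pser F := fun i => c * f i.
Definition pser_one : pser F := fun i => (i == 0%N)%:R.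
Definition pser_mul f g : pser F := fun n => \sum_(i < n.+1) f i * g (n - i)%N.

Lemma pser_addA : associative pser_add.
Proof. by move=> f g h; apply: funext => i; apply: addrA. Qed.
Lemma pser_addC : commutative pser_add.
Proof. by move=> f g; apply: funext => i; apply: addrC. Qed.
Lemma pser_add0 : left_id pser_zero pser_add.
Proof. by move=> f; apply: funext => i; apply: add0r. Qed.
Lemma pser_addN : left_inverse pser_zero pser_opp pser_add.
Proof. by move=> f; apply: funext => i; apply: addNr. Qed.

HB.instance Definition _ :=
  GRing.isZmodule.Build (pser F) pser_addA pser_addC pser_add0 pser_addN.

Definition trunc N f : {poly F} := \poly_(i < N) f i.

Lemma coef_trunc N f i : (i < N)%N -> (trunc N f)`_i = f i.
Proof. by move=> iN; rewrite coef_poly iN. Qed.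

(** Reduces the ring laws to those of polynomials, one coefficient at a time. *)
Lemma pser_mul_trunc N f g n : (n < N)%N -> pser_mul f g n = (trunc N f * trunc N g)`_n.
Proof.
move=> nN; rewrite coefM; apply: eq_bigr => i _.
by rewrite !coef_trunc //; have := ltn_ord i; lia.
Qed.

Lemma pser_mulC : commutative pser_mul.
Proof.
by move=> f g; apply: funext => n; rewrite !(pser_mul_trunc _ _ (ltnSn n)) mulrC.
Qed.

Lemma pser_mulA : associative pser_mul.
Proof.
have E f g h n : pser_mul f (pser_mul g h) n =
    (trunc n.+1 f * (trunc n.+1 g * trunc n.+1 h))`_n.
  rewrite (pser_mul_trunc _ _ (ltnSn n)) !coefM; apply: eq_bigr => i _.
  have ni : (n - i < n.+1)%N by lia.
  by rewrite (coef_trunc (pser_mul g h) ni) (pser_mul_trunc _ _ ni).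
move=> f g h; apply: funext => n; rewrite [in RHS]pser_mulC !E.
by rewrite mulrA mulrC.
Qed.

Lemma pser_mul1 : left_id pser_one pser_mul.
Proof.
move=> f; apply: funext => n; rewrite /pser_mul big_ord_recl /= mul1r subn0.
by rewrite big1 ?addr0 // => i _; rewrite mul0r.
Qed.

Lemma pser_mulDl : left_distributive pser_mul pser_add.
Proof.
move=> f g h; apply: funext => n; rewrite /pser_mul /pser_add -big_split.
by apply: eq_bigr => i _; apply: mulrDl.
Qed.

Lemma pser_one_neq0 : pser_one != pser_zero.
Proof. by apply/eqP => /(congr1 (fun f : pser F => f 0%N))/eqP; rewrite oner_eq0. Qed.

HB.instance Definition _ := GRing.Zmodule_isComNzRing.Build (pser F)
  pser_mulA pser_mulC pser_mul1 pser_mulDl pser_one_neq0.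

Lemma pser_scaleA a b f : pser_scale a (pser_scale b f) = pser_scale (a * b) f.
Proof. by apply: funext => i; apply: mulrA. Qed.
Lemma pser_scale1 : left_id 1 pser_scale.
Proof. by move=> f; apply: funext => i; apply: mul1r. Qed.
Lemma pser_scaleDr : right_distributive pser_scale +%R.
Proof. by move=> a f g; apply: funext => i; apply: mulrDr. Qed.
Lemma pser_scaleDl f : {morph pser_scale^~ f : a b / a + b}.
Proof. by move=> a b; apply: funext => i; apply: mulrDl. Qed.

HB.instance Definition _ := GRing.Zmodule_isLmodule.Build F (pser F)
  pser_scaleA pser_scale1 pser_scaleDr pser_scaleDl.

Lemma pser_scaleAl (a : F) f g : a *: (f * g) = (a *: f) * g.
Proof.
apply: funext => n; rewrite [LHS]mulr_sumr; apply: eq_bigr => i _; exact: mulrA.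
Qed.

HB.instance Definition _ := GRing.Lmodule_isLalgebra.Build F (pser F) pser_scaleAl.
HB.instance Definition _ := GRing.Lalgebra_isComAlgebra.Build F (pser F).

Lemma pser_mulE f g n : (f * g) n = \sum_(i < n.+1) f i * g (n - i)%N.
Proof. by []. Qed.

Lemma pser_sumE (I : Type) (r : seq I) (P : pred I) (E : I -> pser F) n :
  (\sum_(i <- r | P i) E i) n = \sum_(i <- r | P i) E i n.
Proof. by elim/big_rec2: _ => // i _ y _ <-. Qed.

(** The monomial $\theta^{-n}$. *)
Definition pserXn (n : nat) : pser F := fun i => (i == n)%:R.

Lemma pserXn_mulE n f i : (pserXn n * f) i = if (i < n)%N then 0 else f (i - n)%N.
Proof.
rewrite pser_mulE; case: ltnP => ni.
  rewrite big1 // => k _; rewrite /pserXn (_ : (_ == _) = false) ?mul0r //.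
  by have := ltn_ord k; lia.
rewrite (bigD1 (Ordinal (ni : (n < i.+1)%N))) //= /pserXn eqxx mul1r big1 ?addr0 // => k kn.
by rewrite -val_eqE /= in kn; rewrite (negPf kn) mul0r.
Qed.

Lemma pserXnD m n : pserXn m * pserXn n = pserXn (m + n).
Proof.
apply: funext => i; rewrite pserXn_mulE /pserXn; case: ltnP => im.
  by rewrite (_ : (i == _) = false) //; lia.
by congr (_%:R); congr nat_of_bool; lia.
Qed.

Lemma pserXn_inj n : injective ( *%R (pserXn n)).
Proof.
move=> f g fg; apply: funext => i; move/(congr1 (fun f : pser F => f (i + n)%N)): fg.
by rewrite !pserXn_mulE ltnNge leq_addl /= addnK.
Qed.

Lemma pser_mul_low n f g i :
  (forall k, (k < n)%N -> f k = 0) -> (i < n)%N -> (f * g) i = 0.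
Proof.
move=> f0 i_n; rewrite pser_mulE big1 // => k _.
by rewrite f0 ?mul0r //; have := ltn_ord k; lia.
Qed.

End PowerSeries.

(** * Inverses of polynomials as power series in 1/theta *)

Section Inverse.
Variable F : finFieldType.

Lemma ser_inv0 (u : nat -> F) : ser_inv u 0 = (u 0%N)^-1.
Proof. by []. Qed.

Lemma size_inv_list (u : nat -> F) m : size (inv_list u m) = m.+1.
Proof. by elim: m => //= m IHm; rewrite size_rcons IHm. Qed.

Lemma nth_inv_list (u : nat -> F) m i : (i <= m)%N -> nth 0 (inv_list u m) i = ser_inv u i.
Proof.
elim: m => [|m IHm]; first by rewrite leqn0 => /eqP->.
rewrite leq_eqVlt => /orP[/eqP-> //|im].
by rewrite /= nth_rcons size_inv_list im IHm.
Qed.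

Lemma ser_invS (u : nat -> F) m :
  ser_inv u m.+1 = - (u 0%N)^-1 * \sum_(i < m.+1) u i.+1 * ser_inv u (m - i)%N.
Proof.
rewrite {1}/ser_inv /= nth_rcons size_inv_list ltnn eqxx; congr (_ * _).
by apply: eq_bigr => i _; rewrite nth_inv_list // leq_subr.
Qed.

Lemma ser_inv_mul (u : pser F) : u 0%N != 0 -> u * (ser_inv u : pser F) = 1.
Proof.
move=> u0; apply: funext => -[|n]; rewrite pser_mulE.
  by rewrite big_ord1 /= ser_inv0 mulfV.
rewrite big_ord_recl /= subn0 ser_invS mulrA mulrN mulfV // mulN1r.
by rewrite addNr.
Qed.

(** The convention $0^{-1} = 0$ propagates through the recursion; this gives [pinv0]. *)
Lemma ser_inv_zero (u : nat -> F) n : (forall i, u i = 0) -> ser_inv u n = 0.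
Proof.
move=> u0; case: n => [|n]; first by rewrite ser_inv0 u0 invr0.
by rewrite ser_invS u0 invr0 oppr0 mul0r.
Qed.

(* Forgets the coefficients of positive powers of theta. *)
Definition toS (x : Kinf F) : pser F := fun i => coef x (- i%:Z).

(* 1/p as a power series in 1/theta; pinv 0 = 0. *)
Definition pinv (p : {poly F}) : pser F := toS (invK (polyK p)).

(* p / theta^N as a power series in 1/theta, for p of degree <= N. *)
Definition revs (N : nat) (p : {poly F}) : pser F := fun i => if (i <= N)%N then p`_(N - i) else 0.

Lemma pinvE p : pinv p = pserXn F (size p).-1 * (ser_inv (revs (size p).-1 p) : pser F).
Proof.
apply: funext => i; rewrite pserXn_mulE /pinv /toS /coef /= lerN2 lez_nat ltnNge.
case: leqP => //= ni; congr (ser_inv _ _); lia.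
Qed.

Lemma pinv_low (p : {poly F}) i : (i < (size p).-1)%N -> pinv p i = 0.
Proof. by rewrite pinvE pserXn_mulE => ->. Qed.

Lemma pinv0 : pinv 0 = 0.
Proof.
apply: funext => i; rewrite pinvE size_poly0 pserXn_mulE ser_inv_zero // => k.
by rewrite /revs coef0 if_same.
Qed.

Lemma revs_shift N (p : {poly F}) : ((size p).-1 <= N)%N ->
  revs N p = pserXn F (N - (size p).-1) * revs (size p).-1 p.
Proof.
move=> pN; apply: funext => i; rewrite pserXn_mulE /revs.
case: ltnP => iN.
  have sz : (size p <= N - i)%N by have := leqSpred (size p); lia.
  by rewrite nth_default ?if_same.
by case: leqP => ?; case: leqP => ?; try lia; [congr nth; lia|].
Qed.

Lemma pinv_revs N (p : {poly F}) : p != 0 -> ((size p).-1 <= N)%N -> pinv p * revs N p = pserXn F N.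
Proof.
move=> p0 pN; rewrite revs_shift // pinvE mulrACA pserXnD subnKC //.
rewrite [X in _ * X]mulrC ser_inv_mul ?mulr1 // /revs subn0.
by rewrite -lead_coefE lead_coef_eq0.
Qed.

(** Multiplying further by [pinv p] yields $\theta^{-N}$, which acts as an injective shift. *)
Lemma revs_inj N (p : {poly F}) : p != 0 -> ((size p).-1 <= N)%N -> injective ( *%R (revs N p)).
Proof.
move=> p0 pN f g fg; apply: (@pserXn_inj F N).
by rewrite -(pinv_revs p0 pN) -!mulrA fg.
Qed.

Lemma revsB N p p' : revs N (p - p') = revs N p - revs N p'.
Proof.
apply: funext => i; rewrite /revs -[RHS]/((if _ then _ else _) - (if _ then _ else _)).
by case: ifP; rewrite ?coefB ?subr0.
Qed.

Lemma revsZ N c p : revs N (c *: p) = c *: revs N p.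
Proof.
apply: funext => i; rewrite /revs -[RHS]/(c * (if _ then _ else _)).
by case: ifP; rewrite ?coefZ ?mulr0.
Qed.

Lemma pinvZ c p : c != 0 -> pinv (c *: p) = c^-1 *: pinv p.
Proof.
move=> c0; have [->|p0] := eqVneq p 0; first by rewrite scaler0 pinv0 scaler0.
have cp0 : c *: p != 0 by rewrite scaler_eq0 negb_or c0.
have szp : ((size (c *: p)).-1 <= (size p).-1)%N by rewrite size_scale.
apply: (revs_inj cp0 szp); rewrite mulrC pinv_revs // revsZ.
by rewrite -scalerAl -scalerAr scalerA mulfV // scale1r mulrC pinv_revs.
Qed.

(** Denominators are cleared with [revs N] of [p], [p'] and [p - p'] for a common [N]; both sides
    become $(r-r')\theta^{-2N}$. *)
Lemma pinv_mul (p p' : {poly F}) : p != 0 -> p' != 0 -> p != p' ->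
  pinv p * pinv p' = pinv (p - p') * (pinv p' - pinv p).
Proof.
move=> p0 p'0 pp'; have d0 : p - p' != 0 by rewrite subr_eq0.
pose N := maxn (size p) (size p').
have szd := size_polyD p (- p'); rewrite size_polyN -/N in szd.
have pN : ((size p).-1 <= N)%N by rewrite /N; lia.
have p'N : ((size p').-1 <= N)%N by rewrite /N; lia.
have dN : ((size (p - p')%R).-1 <= N)%N by lia.
apply: (revs_inj p0 pN); apply: (revs_inj p'0 p'N); apply: (revs_inj d0 dN).
have := pinv_revs p0 pN; have := pinv_revs p'0 p'N; have := pinv_revs d0 dN.
move: (pinv p) (pinv p') (pinv (p - p')) (pserXn F N) => a a' d T.
rewrite revsB; move: (revs N p) (revs N p') => r r' dT a'T aT.
transitivity ((r - r') * (a' * r') * (a * r)); first by ring.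
transitivity ((d * (r - r')) * (r * (a' * r') - r' * (a * r))); last by ring.
by rewrite dT aT a'T; ring.
Qed.

End Inverse.

(** * From Laurent series to power series *)

Section Bridge.
Variable F : finFieldType.
Implicit Types x y : Kinf F.

Lemma coef_gt_lv x k : lv x < k -> coef x k = 0.
Proof. by rewrite /coef ltNge => /negPf->. Qed.

Lemma coef_lv x i : coef x (lv x - i%:Z) = ser x i.
Proof.
have xi : lv x - i%:Z <= lv x by lia.
have abs_i : `|(lv x - (lv x - i%:Z))%R|%N = i by lia.
by rewrite /coef xi abs_i.
Qed.

Lemma coef_zeroK k : coef (zeroK F) k = 0.
Proof. by rewrite /coef; case: ifP. Qed.

Lemma coef_addK x y k : coef (addK x y) k = coef x k + coef y k.
Proof.
rewrite [LHS]/coef /=; case: ifPn => [km|].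
  by congr (coef x _ + coef y _); lia.
move=> km; have [xk yk] : lv x < k /\ lv y < k by lia.
by rewrite (coef_gt_lv xk) (coef_gt_lv yk) addr0.
Qed.

Lemma coef_scaleK c x k : coef (scaleK c x) k = c * coef x k.
Proof. by rewrite /coef /=; case: ifP; rewrite ?mulr0. Qed.

Lemma coef_constK (c : F) k : coef (constK c) k = if k == 0 then c else 0.
Proof.
rewrite /coef /=; have [->|k0] := eqVneq k 0; first by rewrite lexx.
have absk : (`|(0 - k)%R|%N == 0%N) = false by lia.
by rewrite absk if_same.
Qed.

(* The Cauchy product can be indexed from any L above the leading exponent of x. *)
Lemma coef_mulK_wide x y (L k : int) (N : nat) :
  lv x <= L -> lv y < k - L + N%:Z ->
  coef (mulK x y) k = \sum_(i < N) coef x (L - i%:Z) * coef y (k - L + i%:Z).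
Proof.
move=> xL yN; have [kxy|kxy] := ltP (lv x + lv y) k.
  rewrite coef_gt_lv // big1 // => i _.
  have [ix|ix] := ltP (lv x) (L - i%:Z); first by rewrite coef_gt_lv ?mul0r.
  by rewrite [X in _ * X]coef_gt_lv ?mulr0 //; lia.
rewrite {1}/coef /= kxy; set n := `|_|%N.
(* The first [M] terms lie above the leading exponent of [x] and the last [r] above that of [y]; the
   middle [n.+1] form the Cauchy product. *)
have [M LM] : exists M : nat, L = lv x + M%:Z by exists `|(L - lv x)%R|%N; lia.
have [r ->] : exists r, N = (M + (n.+1 + r))%N by exists (N - (M + n.+1))%N; lia.
rewrite big_split_ord big_split_ord /= [X in _ = X + _]big1 ?add0r => [|i _]; last first.
  by rewrite coef_gt_lv ?mul0r //; have := ltn_ord i; lia.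
rewrite [X in _ = _ + X]big1 ?addr0 => [|i _]; last first.
  by rewrite [X in _ * X]coef_gt_lv ?mulr0 //; lia.
apply: eq_bigr => i _; have := ltn_ord i => i_n.
congr (_ * _); rewrite -coef_lv; congr (coef _ _); lia.
Qed.

(* Elements of F[[1/theta]]; lv x may still be positive, as for the limits zetaW. *)
Definition integral x := forall k : int, 0 < k -> coef x k = 0.

Lemma integral_lv x : lv x <= 0 -> integral x.
Proof. by move=> x0 k k0; apply: coef_gt_lv; lia. Qed.

Lemma integral_addK x y : integral x -> integral y -> integral (addK x y).
Proof. by move=> ix iy k k0; rewrite coef_addK ix ?iy ?addr0. Qed.

Lemma integral_scaleK c x : integral x -> integral (scaleK c x).
Proof. by move=> ix k k0; rewrite coef_scaleK ix ?mulr0. Qed.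

Lemma integral_sum (I : Type) (r : seq I) (P : pred I) (E : I -> Kinf F) :
  (forall i, integral (E i)) -> integral (\big[@addK F/zeroK F]_(i <- r | P i) E i).
Proof.
move=> iE; elim/big_rec: _ => [|i x _ ix]; first exact: integral_lv.
exact: integral_addK.
Qed.

Lemma integral_mulK x y : integral x -> integral y -> integral (mulK x y).
Proof.
move=> ix iy k k0; pose L := Num.max (lv x) 0.
rewrite (@coef_mulK_wide _ _ L k `|(lv y - k + L + 1)%R|%N); try (rewrite /L; lia).
rewrite big1 // => i _; have [iL|iL] := ltP 0 (L - i%:Z); first by rewrite ix ?mul0r.
by rewrite iy ?mulr0 //; lia.
Qed.

(** Integrality ensures that no positive power of $\theta$ in one factor feeds into the retained
    coefficients. *)
Lemma toS_mulK x y : integral x -> integral y -> toS (mulK x y) = toS x * toS y.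
Proof.
move=> ix iy; apply: funext => m; rewrite pser_mulE /toS.
pose L := `|lv x|%N; pose r := `|lv y|%N.
rewrite (@coef_mulK_wide _ _ L%:Z _ (L + (m.+1 + r))%N); try (rewrite /L /r; lia).
rewrite big_split_ord big_split_ord /= big1 ?add0r => [|i _]; last first.
  by rewrite ix ?mul0r //; have := ltn_ord i; lia.
rewrite [X in _ + X]big1 ?addr0 => [|i _]; last first.
  by rewrite iy ?mulr0 //; lia.
apply: eq_bigr => i _; have := ltn_ord i => i_m.
congr (coef _ _ * coef _ _); lia.
Qed.

Lemma toS_zeroK : toS (zeroK F) = 0.
Proof. by apply: funext => i; apply: coef_zeroK. Qed.

Lemma toS_addK x y : toS (addK x y) = toS x + toS y.
Proof. by apply: funext => i; apply: coef_addK. Qed.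

Lemma toS_scaleK c x : toS (scaleK c x) = c *: toS x.
Proof. by apply: funext => i; apply: coef_scaleK. Qed.

Lemma toS_constK (c : F) : toS (constK c) = c%:A.
Proof.
apply: funext => i; rewrite /toS coef_constK -[RHS]/(c * (i == 0%N)%:R) oppr_eq0.
by case: i => [|i] /=; rewrite ?mulr1 ?mulr0.
Qed.

Lemma toS_sum (I : Type) (r : seq I) (P : pred I) (E : I -> Kinf F) :
  toS (\big[@addK F/zeroK F]_(i <- r | P i) E i) = \sum_(i <- r | P i) toS (E i).
Proof. exact: (big_morph _ toS_addK toS_zeroK). Qed.

Lemma toS_Keq x y : integral x -> integral y -> toS x = toS y -> Keq x y.
Proof.
move=> ix iy xy k; have [k0|k0] := ltP 0 k; first by rewrite ix ?iy.
have kE : - (`|k|%N)%:Z = k by lia.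
by move/(congr1 (fun f => f `|k|%N)): xy; rewrite /toS kE.
Qed.

Lemma integral_constK (c : F) : integral (constK c).
Proof. exact: integral_lv. Qed.

Lemma integral_expK x s : integral x -> integral (expK x s).
Proof.
by move=> ix; elim: s => [|s IHs]; [apply: integral_constK | apply: integral_mulK].
Qed.

Lemma toS_expK x s : integral x -> toS (expK x s) = toS x ^+ s.
Proof.
move=> ix; elim: s => [|s IHs]; first by rewrite toS_constK scale1r.
by rewrite exprS -IHs -toS_mulK //; apply: integral_expK.
Qed.

Lemma integral_inv_polyK (p : {poly F}) : integral (invK (polyK p)).
Proof. by apply: integral_lv; rewrite /=; lia. Qed.

(** * The truncated sums as power series *)

Local Notation P := (power_sum (@pinv F)).
Local Notation S := (psum P).
Local Notation SS := (psumD P).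

Lemma pinv_power_sum_mul n a b : (0 < a)%N -> (0 < b)%N ->
  P n a * P n b = P n (a + b)%N + \sum_(j <- iota 1 (a + b).-1)
    Delta F a b j *: (P n (a + b - j)%N * \sum_(m < n) P m j).
Proof. exact: (power_sum_mul (@pinv0 F) (@pinvZ F) (@pinv_mul F)). Qed.

Lemma integral_Sw w (d : int) : integral (@Sw F w d).
Proof.
elim: w d => [|x w IHw] d /=; first exact: integral_constK.
apply: integral_sum => n; apply: integral_sum => f.
apply: integral_mulK; first exact: integral_constK.
by apply: integral_mulK => //; apply/integral_expK/integral_inv_polyK.
Qed.

(** For negative [d] no degree is admissible, exactly as for [d = 0]. *)
Definition nat_bound (d : int) : nat := if d is Posz n then n else 0.

Lemma toS_Sw w (d : int) : toS (@Sw F w d) = S w (nat_bound d).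
Proof.
elim: w d => [|x w IHw] d /=; first by rewrite toS_constK scale1r.
rewrite toS_sum; case: d => [d|d] /=; last first.
  by rewrite big_ord0 big_pred0.
rewrite (eq_bigl xpredT) => [|n]; last by rewrite ltz_nat ltn_ord.
apply: eq_bigr => n _; rewrite toS_sum mulr_suml scaler_sumr.
apply: eq_bigr => f _.
have iE := integral_expK (lw x) (integral_inv_polyK (monic_of f)).
rewrite !toS_mulK //; try exact: integral_Sw; try exact: integral_constK.
  by rewrite toS_constK toS_expK ?IHw -?scalerAl ?mul1r //; apply: integral_inv_polyK.
by apply: integral_mulK => //; apply: integral_Sw.
Qed.

Lemma integral_SD a d : integral (@SD F a d).
Proof. by apply: integral_sum => p; apply/integral_scaleK/integral_Sw. Qed.

Lemma toS_SD a d : toS (@SD F a d) = SS a (nat_bound d).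
Proof. by rewrite toS_sum; apply: eq_bigr => p _; rewrite toS_scaleK toS_Sw. Qed.

Lemma power_sum_low n s i : (0 < s)%N -> (i < n)%N -> P n s i = 0.
Proof.
case: s => // s _ i_n; rewrite /power_sum pser_sumE big1 // => f _.
rewrite exprS (@pser_mul_low _ n) // => k kn.
by rewrite pinv_low // size_monic_of.
Qed.

(** Leading degree $n$ contributes only from $\theta^{-n}$ on, by [power_sum_low], so degrees above
    [i] leave coefficient [i] unchanged. *)
Lemma psum_stable w d i : all (@validL F) w -> (i < d)%N -> S w d i = S w i.+1 i.
Proof.
case: w => [|x w] //= /andP[/andP[x0 _] _]; elim: d => // d IHd.
rewrite ltnS leq_eqVlt => /orP[/eqP-> //|id].
rewrite big_ord_recr /= -[LHS]/(_ + _ * _) IHd //.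
by rewrite (@pser_mul_low _ d) ?mulr0 ?addr0 // => k; apply: power_sum_low.
Qed.

Lemma psumD_stable a d i : validD a -> (i < d)%N -> SS a d i = SS a i.+1 i.
Proof.
move=> va id; rewrite /psumD !pser_sumE; apply: eq_bigr_all va _ => p vp.
by rewrite -[LHS]/(_ * _) psum_stable.
Qed.

(** * The limit zeta values *)

Lemma Klim_unique (u : int -> Kinf F) x y : Klim u x -> Klim u y -> Keq x y.
Proof.
move=> ux uy k; have [[D hx] [D' hy]] := (ux k, uy k).
by rewrite -(hx (Num.max D D')) ?hy //; lia.
Qed.

(** Reads coefficient [i] at [i.+1], a bound from which it is stable. *)
Definition zeta_ser (w : word F) : pser F := fun i => S w i.+1 i.

Lemma Klim_zeta_ser w : all (@validL F) w ->
  Klim (fun d => Sw w d) (MkK 0 (zeta_ser w)).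
Proof.
(* If $k \le j \le 0$ then $|j| \le |k| < d$, so coefficient $|j|$ is already stable at [d]. *)
move=> vw k; exists (`|k|%N.+1)%:Z => d Dd j kj.
have [j0|j0] := ltP 0 j; first by rewrite integral_Sw // coef_gt_lv.
have {1}-> : j = - (`|j|%N)%:Z by lia.
rewrite -[LHS]/(toS (Sw w d) `|j|%N) toS_Sw /coef /= j0 sub0r abszN.
case: d Dd => [d|d] Dd /=; last by lia.
by rewrite psum_stable //; lia.
Qed.

(** [epsilon] returns some limit because one exists; uniqueness of limits identifies it up to
    [Keq]. *)
Lemma zetaW_Keq w : all (@validL F) w -> Keq (zetaW w) (MkK 0 (zeta_ser w)).
Proof.
move=> vw; have ex := Klim_zeta_ser vw.
have : Klim (fun d => Sw w d) (zetaW w).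
  by rewrite /zetaW; apply: epsilon_spec; exists (MkK 0 (zeta_ser w)).
by move/Klim_unique; apply.
Qed.

Lemma integral_zetaW w : all (@validL F) w -> integral (zetaW w).
Proof. by move=> vw k k0; rewrite zetaW_Keq // coef_gt_lv. Qed.

Lemma toS_zetaW w i : all (@validL F) w -> toS (zetaW w) i = S w i.+1 i.
Proof.
move=> vw; rewrite /toS zetaW_Keq //.
by have := coef_lv (MkK 0 (zeta_ser w)) i; rewrite /= sub0r => ->.
Qed.

Lemma integral_zetaD a : validD a -> integral (@zetaD F a).
Proof.
rewrite /zetaD; elim: a => [|p a IHa] /=; first by rewrite big_nil => _; apply: integral_lv.
case/andP=> vp va; rewrite big_cons; apply: integral_addK (IHa va).
by apply/integral_scaleK/integral_zetaW.
Qed.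

Lemma toS_zetaD a i : validD a -> toS (@zetaD F a) i = SS a i.+1 i.
Proof.
move=> va; rewrite toS_sum /psumD !pser_sumE; apply: eq_bigr_all va _ => p vp.
by rewrite toS_scaleK -[LHS]/(_ * _) toS_zetaW.
Qed.

Lemma validD_shD (a b : Dsp F) : validD a -> validD b -> validD (shD a b).
Proof.
rewrite /validD => + vb; elim: a => [|p a IHa] //= /andP[vp va].
rewrite /shD /= flatten_cat all_cat [X in _ && X]IHa // andbT.
apply: all_flatten_map vb _ => p' vp'; rewrite all_map /=.
by apply: sub_all (sh_valid _ vp vp') => ? /andP[].
Qed.

End Bridge.

Theorem theorem5p11 (F : finFieldType) (a b : Dsp F) (d : int) :
  validD a -> validD b ->
  Keq (SD (shD a b) d) (mulK (SD a d) (SD b d)) /\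
  Keq (zetaD (shD a b)) (mulK (zetaD a) (zetaD b)).
Proof.
move=> va vb; have P_mul := @pinv_power_sum_mul F.
split; apply: toS_Keq.
- exact: integral_SD.
- by apply: integral_mulK; apply: integral_SD.
- by rewrite toS_mulK ?toS_SD ?(psumD_shD P_mul) //; apply: integral_SD.
- exact/integral_zetaD/validD_shD.
- by apply: integral_mulK; apply: integral_zetaD.
rewrite toS_mulK; try exact: integral_zetaD.
apply: funext => i; rewrite toS_zetaD ?(psumD_shD P_mul) //; last exact: validD_shD.
(* Coefficient [i] of the product involves only coefficients up to [i], all of which can be read at
   the same bound [i.+1]. *)
rewrite !pser_mulE; apply: eq_bigr => k _; have := ltn_ord k => ki.
by rewrite !toS_zetaD // (psumD_stable va ki) (psumD_stable vb (_ : (i - k < i.+1)%N)) //; lia.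
Qed.
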